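(* Fix $\alpha>1$. Consider the closed-loop system consisting of the state equation $\dot x(t)=f(x(t),u(t))$, $x(0)=x_0$, the output equation $y(t)=h(x(t))$, and the controller equation $$\dot u(t)=\Big(\frac{\partial g}{\partial u}(x(t),u(t))\Big)^{-1}\Big(\alpha\big(r(t+T)-\hat y(t+T)\big)+\dot r(t+T)-\frac{\partial g}{\partial x}(x(t),u(t))\,f(x(t),u(t))+\mathcal E_2(t)\Big),$$ where $\hat y(t+T)=g(x(t),u(t))$ and $\mathcal E_2(t)\in\mathbb R^m$ is an additive error. Let $\eta_1:=\limsup_{t\to\infty}\|\hat y(t+T)-y(t+T)\|$ and $\eta_2:=\limsup_{t\to\infty}\|\mathcal E_2(t)\|$. If the trajectory of the closed-loop system is nonsingular, then $$\limsup_{t\to\infty}\|r(t)-y(t)\|\le\eta_1+\frac{\eta_2}{\alpha}.$$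
   Context: Setting: $x(t)\in\mathbb R^n$ is the state, $u(t)\in\mathbb R^m$ the control input, $y(t)\in\mathbb R^m$ the output, $r(t)\in\mathbb R^m$ the reference signal, and $T>0$ a fixed lookahead time. Standing assumptions. (1) $f:\mathbb R^n\times\mathbb R^m\to\mathbb R^n$ is continuously differentiable, and for every compact set $\Gamma\subset\mathbb R^m$ there is $K>0$ such that $\|f(x,u)\|\le K(\|x\|+1)$ for all $x\in\mathbb R^n$, $u\in\Gamma$; $h:\mathbb R^n\to\mathbb R^m$ is continuously differentiable. (2) $g:\mathbb R^n\times\mathbb R^m\to\mathbb R^m$ (the output predictor) is continuously differentiable in $(x,u)$. (3) $r(\cdot)$ is continuous and piecewise differentiable; equations containing $\dot r(t+T)$ are understood at those $t$ where this derivative exists. Notation. The predicted output is $\hat y(t+T):=g(x(t),u(t))$ for $t\ge0$, i.e. $\hat y(t)=g(x(t-T),u(t-T))$ for $t\ge T$. $\|\cdot\|$ is the Euclidean norm. A closed-loop trajectory (defined for all $t\ge 0$) is called nonsingular if the partial Jacobian $\frac{\partial g}{\partial u}(x(t),u(t))$ is nonsingular for every $t\ge0$. *)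

(* Defs.v *)
From HB Require Import structures.
From mathcomp Require Import all_boot all_order all_algebra.
From mathcomp Require Import all_classical all_reals all_analysis.
Set Implicit Arguments.
Unset Strict Implicit.
Unset Printing Implicit Defensive.
Import Order.TTheory GRing.Theory Num.Theory.
Import numFieldNormedType.Exports.
Local Open Scope classical_set_scope.
Local Open Scope ring_scope.

(* Vectors of R^n are rows 'rV[R]_n and the library Jacobian 'J acts on the
   right ('d f p v = v *m 'J f p), so every matrix formula below is the
   transpose of the usual one on columns.  Functions of the time t >= 0 are
   total on R, but only their values on [0, +oo[ are constrained or used. *)

(* The library norm `|v| on 'rV[R]_n is the sup norm. *)
Definition enorm (R : realType) (n : nat) (v : 'rV[R]_n) : R :=
  Num.sqrt (\sum_(i < n) v 0 i ^+ 2).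

(* Between finite-dimensional spaces, pointwise continuity of p |-> 'd f p is
   the same as its continuity in operator norm. *)
Definition continuously_differentiable (R : realType) (U V : normedModType R)
    (f : U -> V) : Prop :=
  (forall p, differentiable f p) /\
  (forall v, continuous (fun p => 'd f p v)).

Definition linear_growth (R : realType) (n m : nat)
    (f : 'rV[R]_n * 'rV[R]_m -> 'rV[R]_n) : Prop :=
  forall Gamma : set 'rV[R]_m, compact Gamma ->
    exists2 K : R, 0 < K &
      forall x u, Gamma u -> enorm (f (x, u)) <= K * (enorm x + 1).

(* The break points are locally finite; nothing is required of one-sided
   derivatives there. *)
Definition piecewise_differentiable (R : realType) (m : nat)
    (r : R -> 'rV[R]_m) : Prop :=
  exists2 S : set R, (forall b, finite_set (S `&` `[0, b])) &
    forall t : R, 0 < t -> ~ S t -> derivable r t 1.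

(* Derivative relative to [0, +oo[: the two-sided one for t > 0 and the right
   one for t = 0. *)
Definition has_time_derivative (R : realType) (n : nat)
    (z : R -> 'rV[R]_n) (t : R) (v : 'rV[R]_n) : Prop :=
  h^-1 *: (z (t + h) - z t) @[h --> within [set h | 0 <= t + h] 0^'] --> v.

Definition dg_dx (R : realType) (n m : nat)
    (g : 'rV[R]_n * 'rV[R]_m -> 'rV[R]_m) (x : 'rV[R]_n) (u : 'rV[R]_m) :
    'M[R]_(n, m) :=
  'J (fun w => g (w, u)) x.

Definition dg_du (R : realType) (n m : nat)
    (g : 'rV[R]_n * 'rV[R]_m -> 'rV[R]_m) (x : 'rV[R]_n) (u : 'rV[R]_m) :
    'M[R]_m :=
  'J (fun w => g (x, w)) u.

(* The controller equation holds at the times t where the derivative of r at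
   t + T exists; at the other times u is only continuous. *)
Record closed_loop_trajectory (R : realType) (n m : nat) (T alpha : R)
    (f : 'rV[R]_n * 'rV[R]_m -> 'rV[R]_n) (h : 'rV[R]_n -> 'rV[R]_m)
    (g : 'rV[R]_n * 'rV[R]_m -> 'rV[R]_m) (r E2 : R -> 'rV[R]_m)
    (x0 : 'rV[R]_n) (x : R -> 'rV[R]_n) (u y yhat : R -> 'rV[R]_m) : Prop := {
  state_initial : x 0 = x0 ;
  state_equation :
    forall t : R, 0 <= t -> has_time_derivative x t (f (x t, u t)) ;
  output_equation : forall t : R, 0 <= t -> y t = h (x t) ;
  predictor_equation : forall t : R, 0 <= t -> yhat (t + T) = g (x t, u t) ;
  control_continuous : {within `[0, +oo[, continuous u} ;
  controller_equation :
    forall t : R, 0 <= t -> derivable r (t + T) 1 ->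
      has_time_derivative u t
        ((alpha *: (r (t + T) - yhat (t + T)) + 'D_1 r (t + T)
          - f (x t, u t) *m dg_dx g (x t) (u t) + E2 t)
         *m invmx (dg_du g (x t) (u t)))
}.

Definition nonsingular_trajectory (R : realType) (n m : nat)
    (g : 'rV[R]_n * 'rV[R]_m -> 'rV[R]_m)
    (x : R -> 'rV[R]_n) (u : R -> 'rV[R]_m) : Prop :=
  forall t : R, 0 <= t -> dg_du g (x t) (u t) \in unitmx.

Definition limsup_enorm (R : realType) (m : nat) (z : R -> 'rV[R]_m) : \bar R :=
  limf_esup (fun t : R => (enorm (z t))%:E) (pinfty_nbhs R).

(* Main.v *)
Require Import Defs.
From HB Require Import structures.
From mathcomp Require Import all_boot all_order all_algebra.
From mathcomp Require Import all_classical all_reals all_analysis.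
From mathcomp Require Import ring lra.
Import Order.TTheory GRing.Theory Num.Theory.
Import numFieldNormedType.Exports.
Local Open Scope classical_set_scope.
Local Open Scope ring_scope.

(** Write e(t) = r(t + T) - g(x(t), u(t)).  The chain rule and the controller
    equation give e' = - alpha e - E2 wherever r is differentiable at t + T.  If
    |E2| <= c after time a then, for every fixed vector w, the function
    exp(alpha (t - a)) (<e(t), w> - c |w| / alpha) is nonincreasing there: it is
    continuous and has a nonpositive derivative off a finite set on each bounded
    interval.  Taking w = e(b) yields
    |e(b)| <= c / alpha + exp(- alpha (b - a)) |e(a)|, so limsup |e| <= eta2 / alpha,
    and the triangle inequality through the predicted output concludes. *)

(** * Euclidean inner product and norm on row vectors *)

Definition dot {R : realType} {m : nat} (v w : 'rV[R]_m) : R :=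
  \sum_(i < m) v 0 i * w 0 i.

Lemma enorm_ge0 {R : realType} {m : nat} (v : 'rV[R]_m) : 0 <= enorm v.
Proof. exact: sqrtr_ge0. Qed.

Lemma sqr_enorm {R : realType} {m : nat} (v : 'rV[R]_m) :
  enorm v ^+ 2 = dot v v.
Proof.
rewrite /enorm sqr_sqrtr; last by apply: sumr_ge0 => i _; exact: sqr_ge0.
by apply: eq_bigr => i _; rewrite expr2.
Qed.

Lemma enorm_eq0 {R : realType} {m : nat} (v : 'rV[R]_m) : enorm v = 0 -> v = 0.
Proof.
move=> v0; have : dot v v = 0 by rewrite -sqr_enorm v0 expr0n.
move=> /eqP; rewrite psumr_eq0 => [/allP v0i|i _]; last first.
  by rewrite -expr2 sqr_ge0.
apply/rowP => i; rewrite mxE; have := v0i i (mem_index_enum i).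
by rewrite mulf_eq0 orbb => /eqP.
Qed.

Lemma dotDl {R : realType} {m : nat} (u v w : 'rV[R]_m) :
  dot (u + v) w = dot u w + dot v w.
Proof.
by rewrite -big_split; apply: eq_bigr => i _; rewrite mxE mulrDl.
Qed.

Lemma dotZl {R : realType} {m : nat} (a : R) (v w : 'rV[R]_m) :
  dot (a *: v) w = a * dot v w.
Proof.
by rewrite /dot mulr_sumr; apply: eq_bigr => i _; rewrite mxE mulrA.
Qed.

Lemma dotC {R : realType} {m : nat} (v w : 'rV[R]_m) : dot v w = dot w v.
Proof. by apply: eq_bigr => i _; rewrite mulrC. Qed.

Lemma dotDr {R : realType} {m : nat} (u v w : 'rV[R]_m) :
  dot u (v + w) = dot u v + dot u w.
Proof. by rewrite dotC dotDl dotC (dotC w). Qed.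

Lemma dotZr {R : realType} {m : nat} (a : R) (v w : 'rV[R]_m) :
  dot v (a *: w) = a * dot v w.
Proof. by rewrite dotC dotZl dotC. Qed.

Lemma dot0l {R : realType} {m : nat} (w : 'rV[R]_m) : dot 0 w = 0.
Proof. by rewrite /dot big1 // => i _; rewrite mxE mul0r. Qed.

Lemma dot_ge0 {R : realType} {m : nat} (v : 'rV[R]_m) : 0 <= dot v v.
Proof. by rewrite -sqr_enorm sqr_ge0. Qed.

(** Cauchy-Schwarz: with v, w nonzero, the squared norm of |w| v - |v| w equals 2 |v| |w| (|v| |w| -
    <v, w>), and the positive factor cancels. *)
Lemma dot_le_enorm {R : realType} {m : nat} (v w : 'rV[R]_m) :
  dot v w <= enorm v * enorm w.
Proof.
have [/enorm_eq0 ->|v0] := eqVneq (enorm v) 0.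
  by rewrite dot0l mulr_ge0 ?enorm_ge0.
have [/enorm_eq0 ->|w0] := eqVneq (enorm w) 0.
  by rewrite dotC dot0l mulr_ge0 ?enorm_ge0.
have vw_gt0 : 0 < enorm v * enorm w.
  by rewrite mulr_gt0 // lt_neqAle eq_sym ?v0 ?w0 enorm_ge0.
have := dot_ge0 (enorm w *: v + (- enorm v) *: w).
rewrite dotDl !dotDr !dotZl !dotZr (dotC w v) -!sqr_enorm => le0.
by rewrite -(ler_pM2l vw_gt0); nra.
Qed.

Lemma enormN {R : realType} {m : nat} (v : 'rV[R]_m) : enorm (- v) = enorm v.
Proof. by congr Num.sqrt; apply: eq_bigr => i _; rewrite mxE sqrrN. Qed.

Lemma enormD {R : realType} {m : nat} (v w : 'rV[R]_m) :
  enorm (v + w) <= enorm v + enorm w.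
Proof.
rewrite -(@ler_pXn2r _ 2) ?nnegrE ?addr_ge0 ?enorm_ge0 //.
rewrite sqr_enorm dotDl !dotDr (dotC w v).
have := dot_le_enorm v w; rewrite sqrrD !sqr_enorm; lra.
Qed.

(** * Limits superior at infinity against eventual bounds *)

Lemma limsup_enorm_ge0 {R : realType} {m : nat} (z : R -> 'rV[R]_m) :
  (0 <= limsup_enorm z)%E.
Proof.
apply: limf_esup_ge0 => [|t]; last by rewrite lee_fin enorm_ge0.
exact: filter_not_empty.
Qed.

Lemma limsup_enorm_le {R : realType} {m : nat} (z : R -> 'rV[R]_m) (A : R) :
  (\forall t \near +oo, enorm (z t) <= A) -> (limsup_enorm z <= A%:E)%E.
Proof.
move=> zA; apply: le_trans.
  by apply: ereal_inf_lbound; exists [set t | enorm (z t) <= A].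
by apply: ub_ereal_sup => _ [t zt <-]; rewrite lee_fin.
Qed.

(** Strictness matters: an infimum of suprema lying below [A] is witnessed by an actual
    neighbourhood of infinity. Callers therefore add a positive slack first. *)
Lemma near_limsup_enorm_lt {R : realType} {m : nat} (z : R -> 'rV[R]_m)
    (A : R) :
  (limsup_enorm z < A%:E)%E -> \forall t \near +oo, enorm (z t) <= A.
Proof.
move=> /ereal_inf_lt[_ [V FV <-] VA].
apply: filterS FV => t Vt; rewrite -lee_fin; apply: le_trans (ltW VA).
by apply: ereal_sup_ubound; exists t.
Qed.

(** * Exponential decay for a perturbed linear equation *)

(** Induction on the exceptional points: one inside the interval cuts it in two, and continuity lets
    the two inequalities chain; one outside is discarded. *)
Lemma nonincreasing_off_seq {R : realType} (phi : R -> R) (s : seq R) (a b : R) :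
  a <= b -> {within `[a, b], continuous phi} ->
  (forall t, a < t < b -> t \notin s -> derivable phi t 1 /\ 'D_1 phi t <= 0) ->
  phi b <= phi a.
Proof.
elim: s a b => [|c s IHs] a b ab cphi dphi.
  apply: (@ler0_derive1_le_cc _ phi a b) => //; rewrite ?in_itv/= ?lexx ?ab //.
  - by move=> t; rewrite in_itv/= => /dphi[].
  - by move=> t; rewrite in_itv/= derive1E => /dphi[].
have [/andP[ac cb]|cab] := boolP (a < c < b).
  apply: (@le_trans _ _ (phi c)).
    apply: IHs => [||t /andP[ct tb] ts]; first exact: ltW.
      apply: continuous_subspaceW cphi.
      move=> t/=; rewrite !in_itv/= => /andP[ct ->].
      by rewrite (le_trans (ltW ac)).
    apply: dphi; first by rewrite (lt_trans ac ct).
    by rewrite inE negb_or ts gt_eqF.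
  apply: IHs => [||t /andP[at' tc] ts]; first exact: ltW.
    apply: continuous_subspaceW cphi.
    move=> t/=; rewrite !in_itv/= => /andP[-> tc].
    by rewrite (le_trans tc (ltW cb)).
  apply: dphi; first by rewrite at' (lt_trans tc cb).
  by rewrite inE negb_or ts lt_eqF.
apply: IHs => // t tab ts; apply: dphi => //.
by rewrite inE negb_or ts andbT; apply: contraNneq cab => <-.
Qed.

Lemma continuous_dot {R : realType} {m : nat} (w : 'rV[R]_m) :
  continuous (fun v => dot v w).
Proof.
have cadd : continuous (fun p : R * R => p.1 + p.2) by exact: add_continuous.
apply: (continuous_big cadd
  (F := fun i (v : 'rV[R]_m) => v 0 i * w 0 i)) => i _ v.
exact: (cvgM (@coord_continuous R 1 m 0 i v) (cvg_cst (w 0 i))).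
Qed.

(** Pairing with a fixed vector is linear and continuous, so it commutes with the limit of
    difference quotients. *)
Lemma is_derive_dot {R : realType} {m : nat} (e : R -> 'rV[R]_m) (t : R)
    (de w : 'rV[R]_m) :
  is_derive t 1 e de -> is_derive t 1 (fun s => dot (e s) w) (dot de w).
Proof.
move=> [ce <-].
suff q : h^-1 *: (((fun s => dot (e s) w) \o shift t) (h *: 1) - dot (e t) w)
    @[h --> 0^'] --> dot ('D_1 e t) w.
  by split; [apply/cvg_ex; eexists; exact: q|exact/cvg_lim].
have := cvg_comp _ _ ce (continuous_dot w ('D_1 e t)).
apply: cvg_trans; apply: near_eq_cvg; near=> h => /=.
by rewrite dotZl dotDl -scaleN1r dotZl mulN1r.
Unshelve. all: by end_near. Qed.

(* Testing the equation against the constant vector [e b] keeps everything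
   linear and avoids differentiating the norm. *)
Lemma enorm_linear_ode_le {R : realType} {m : nat} (e E : R -> 'rV[R]_m)
    (s : seq R) (alpha c a b : R) :
  0 < alpha -> 0 <= c -> a <= b ->
  (forall t, a <= t <= b -> {for t, continuous e}) ->
  (forall t, a < t < b -> t \notin s ->
    is_derive t 1 e (- (alpha *: e t + E t))) ->
  (forall t, a < t < b -> enorm (E t) <= c) ->
  enorm (e b) <= c / alpha + expR (- (alpha * (b - a))) * enorm (e a).
Proof.
move=> alpha0 c0 ab ce de Ec.
(* Since <e, w>' <= - alpha <e, w> + c |w|, [k] is the equilibrium of the scalar bound and [q] its
   integrating factor, normalised by [q a = 1]. *)
pose w := e b; pose k := c * enorm w / alpha.
pose q t := expR (alpha * (t - a)).
pose phi t := q t * (dot (e t) w - k).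
have dq (t : R) : is_derive t 1 q (alpha * q t).
  have := is_deriveZ alpha (is_deriveB (is_derive_id t 1) (is_derive_cst a t 1)).
  rewrite subr0 [alpha *: 1]mulr1 => dl; rewrite mulrC.
  exact: (is_derive1_comp (is_derive_expR _) dl).
have phiba : phi b <= phi a.
  apply: (@nonincreasing_off_seq _ phi s) => //.
    apply: continuous_in_subspaceT => t; rewrite inE/= in_itv/= => /ce cet.
    apply: cvgM.
      apply: (@differentiable_continuous _ _ _ t q).
      by apply/derivable1_diffP; exact: (@ex_derive _ _ _ _ _ _ _ (dq t)).
    apply: cvgB; last exact: cvg_cst.
    exact: (continuous_comp cet (continuous_dot w (e t))).
  move=> t tab ts.
  have dphi := is_deriveM (dq t)
    (is_deriveB (is_derive_dot _ _ _ w (de t tab ts)) (is_derive_cst k t 1)).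
  split; first exact: (@ex_derive _ _ _ _ _ _ _ dphi).
  rewrite (@derive_val _ _ _ _ _ _ _ dphi) /GRing.scale/= subr0.
  have q0 : 0 < q t by exact: expR_gt0.
  rewrite -scaleN1r dotZl dotDl dotZl.
  have : - dot (E t) w <= c * enorm w.
    rewrite -mulN1r -dotZl scaleN1r; apply: le_trans (dot_le_enorm _ _) _.
    by rewrite enormN ler_wpM2r ?enorm_ge0 ?Ec.
  have : alpha * k = c * enorm w by rewrite /k mulrC divfK ?gt_eqF.
  rewrite !fctE/=; nra.
(* The conclusion is reached by dividing by |w|; for w = 0 its left side vanishes. *)
have [W0|W0] := eqVneq (enorm w) 0.
  by rewrite -/w W0 addr_ge0 ?divr_ge0 ?mulr_ge0 ?enorm_ge0 ?expR_ge0
    ?(ltW alpha0).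
have {}W0 : 0 < enorm w by rewrite lt_neqAle eq_sym W0 enorm_ge0.
have qb0 : 0 < q b by exact: expR_gt0.
rewrite expRN -/(q b) -/w -lerBlDl -(ler_pM2l qb0) mulrA mulfV ?gt_eqF // mul1r.
rewrite -(ler_pM2r W0).
(* As <e b, w> = |w|^2, [phiba] reads q(b) (|w|^2 - k) <= <e a, w> - k, whose right side is at most
   |e a| |w|. *)
move: phiba; rewrite /phi {2}/q subrr mulr0 expR0 mul1r -/w -sqr_enorm.
have kE : k = c / alpha * enorm w by rewrite /k mulrAC.
have := dot_le_enorm (e a) w.
have : 0 <= k by rewrite divr_ge0 ?mulr_ge0 ?enorm_ge0 ?(ltW alpha0).
rewrite -mulrA mulrBl -kE -expr2; lra.
Qed.

(** * Time derivatives and the chain rule through partial Jacobians *)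

Lemma is_derive_cvg {R : realType} {m : nat} (z : R -> 'rV[R]_m) (t : R)
    (v : 'rV[R]_m) :
  h^-1 *: (z (t + h) - z t) @[h --> 0^'] --> v -> is_derive t 1 z v.
Proof.
move=> q.
have {}q : h^-1 *: ((z \o shift t) (h *: 1) - z t) @[h --> 0^'] --> v.
  apply: cvg_trans q; apply: near_eq_cvg; near=> h => /=.
  by rewrite [h *: 1]mulr1 (addrC h).
by split; [apply/cvg_ex; exists v|exact/cvg_lim].
Unshelve. all: by end_near. Qed.

(** For |h| < t the constraint [0 <= t + h] is automatic, so the relative filter is the full
    punctured one. *)
Lemma has_time_derivative_is_derive {R : realType} {m : nat} (z : R -> 'rV[R]_m)
    (t : R) (v : 'rV[R]_m) :
  0 < t -> has_time_derivative z t v -> is_derive t 1 z v.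
Proof.
move=> t0 q; apply: is_derive_cvg; apply: cvg_trans q.
apply: cvg_app => P WP.
have A : \forall h \near (0 : R)^', 0 <= t + h.
  apply: nbhs_dnbhs; exists t => //= h; rewrite /ball/= sub0r normrN => /ltW.
  by rewrite ler_norml -subr_ge0 opprK addrC => /andP[].
by apply: filterS2 A WP => h Ah; exact.
Qed.

Lemma continuous_within_itvcy_at {R : realType} {U : topologicalType}
    (z : R -> U) (a t : R) :
  {within `[a, +oo[, continuous z} -> a < t -> {for t, continuous z}.
Proof.
move=> /subspace_continuousP cz at'.
have := cz t; rewrite within_interior; first by apply; rewrite /= in_itv/= ltW.
apply: (@filterS _ _ _ `]a, +oo[).
  by move=> s/=; rewrite !in_itv/= !andbT => /ltW.
by apply: open_nbhs_nbhs; split; [exact: interval_open|rewrite /= in_itv/= at'].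
Qed.

Lemma is_derive_shift {R : realType} {V : normedModType R} (z : R -> V)
    (T t : R) (dz : V) :
  is_derive (t + T) 1 z dz -> is_derive t 1 (fun s => z (s + T)) dz.
Proof.
case=> cz <-.
have E : (fun h : R =>
    h^-1 *: (((fun s => z (s + T)) \o shift t) (h *: 1) - z (t + T))) =
  (fun h : R => h^-1 *: ((z \o shift (t + T)) (h *: 1) - z (t + T))).
  by apply/funext => h /=; rewrite addrA.
by split; rewrite /derivable /derive E.
Qed.

(** Each partial Jacobian is the differential of [g] composed with an affine slice through (x, u);
    linearity on (dx, 0) + (0, du) then joins the two. *)
Lemma diff_partials {R : realType} {n m p : nat}
    (g : 'rV[R]_n * 'rV[R]_m -> 'rV[R]_p)
    (x dx : 'rV[R]_n) (u du : 'rV[R]_m) :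
  differentiable g (x, u) ->
  'd g (x, u) (dx, du) =
  dx *m 'J (fun w => g (w, u)) x + du *m 'J (fun w => g (x, w)) u.
Proof.
move=> dg; rewrite /jacobian !mul_rV_lin1.
have dl : differentiable (fun w : 'rV[R]_n => (w, u)) x
  by exact: differentiable_pair.
have dr : differentiable (fun w : 'rV[R]_m => (x, w)) u
  by exact: differentiable_pair.
have diff_idE k (w dw : 'rV[R]_k) : 'd (fun v => v) w dw = dw
  by rewrite (@diff_val _ _ _ _ _ _ _ (is_diff_id w)).
have -> : 'd (fun w => g (w, u)) x dx = 'd g (x, u) (dx, 0).
  have -> := congr1 (fun F => F dx) (diff_comp dl dg).
  by rewrite /= diff_pair //= diff_cst diff_idE.
have -> : 'd (fun w => g (x, w)) u du = 'd g (x, u) (0, du).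
  have -> := congr1 (fun F => F du) (diff_comp dr dg).
  by rewrite /= diff_pair //= diff_cst diff_idE.
rewrite -linearD/=; congr ('d g _ _).
by transitivity (dx + 0, 0 + du); first by rewrite addr0 add0r.
Qed.

Lemma is_derive_partials {R : realType} {n m p : nat}
    (g : 'rV[R]_n * 'rV[R]_m -> 'rV[R]_p)
    (x : R -> 'rV[R]_n) (u : R -> 'rV[R]_m) (t : R)
    (dx : 'rV[R]_n) (du : 'rV[R]_m) :
  differentiable g (x t, u t) -> is_derive t 1 x dx -> is_derive t 1 u du ->
  is_derive t 1 (fun s => g (x s, u s))
    (dx *m 'J (fun w => g (w, u t)) (x t) +
     du *m 'J (fun w => g (x t, w)) (u t)).
Proof.
move=> dg [/derivable1_diffP ddx <-] [/derivable1_diffP ddu <-].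
have dp : differentiable (fun s => (x s, u s)) t by exact: differentiable_pair.
have dgp : differentiable (g \o (fun s => (x s, u s))) t
  by exact: differentiable_comp.
split; first exact/derivable1_diffP.
rewrite (deriveE _ dgp) diff_comp //= diff_pair //= diff_partials //.
by rewrite !deriveE.
Qed.

(** * The prediction error along a closed-loop trajectory *)

(** Carries the decay estimate across the break points of [r], where the controller equation is
    silent: [u] is continuous by assumption, [x] because it is differentiable. *)
Lemma continuous_prediction_error {R : realType} {n m : nat} {T alpha : R}
    {f : 'rV[R]_n * 'rV[R]_m -> 'rV[R]_n} {h : 'rV[R]_n -> 'rV[R]_m}
    {g : 'rV[R]_n * 'rV[R]_m -> 'rV[R]_m} {r E2 : R -> 'rV[R]_m}
    {x0 : 'rV[R]_n} {x : R -> 'rV[R]_n} {u y yhat : R -> 'rV[R]_m} :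
  0 < T -> (forall p, differentiable g p) ->
  {within `[0, +oo[, continuous r} ->
  closed_loop_trajectory T alpha f h g r E2 x0 x u y yhat ->
  forall t, 0 < t -> {for t, continuous (fun s => r (s + T) - g (x s, u s))}.
Proof.
move=> T_gt0 g_diff r_cont traj t t0; apply: cvgB.
  apply: (@continuous_comp _ _ _ (fun s => s + T) r).
    by apply: cvgD; [exact: cvg_id|exact: cvg_cst].
  exact: (continuous_within_itvcy_at _ _ _ r_cont (addr_gt0 t0 T_gt0)).
apply: (@continuous_comp _ _ _ (fun s => (x s, u s)) g); last first.
  exact: differentiable_continuous.
have cx : {for t, continuous x}.
  have dx := has_time_derivative_is_derive _ _ _ t0 (state_equation traj (ltW t0)).
  apply: (@differentiable_continuous _ _ _ t x).
  by apply/derivable1_diffP; exact: (@ex_derive _ _ _ _ _ _ _ dx).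
have cu := continuous_within_itvcy_at _ _ _ (control_continuous traj) t0.
exact: (cvg_pair cx cu).
Qed.

(* The controller inverts the input Jacobian of the predictor exactly, so the
   state and reference feedforward terms cancel. *)
Lemma is_derive_prediction_error {R : realType} {n m : nat} {T alpha : R}
    {f : 'rV[R]_n * 'rV[R]_m -> 'rV[R]_n} {h : 'rV[R]_n -> 'rV[R]_m}
    {g : 'rV[R]_n * 'rV[R]_m -> 'rV[R]_m} {r E2 : R -> 'rV[R]_m}
    {x0 : 'rV[R]_n} {x : R -> 'rV[R]_n} {u y yhat : R -> 'rV[R]_m} :
  (forall p, differentiable g p) ->
  closed_loop_trajectory T alpha f h g r E2 x0 x u y yhat ->
  nonsingular_trajectory g x u ->
  forall t, 0 < t -> derivable r (t + T) 1 ->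
  is_derive t 1 (fun s => r (s + T) - g (x s, u s))
    (- (alpha *: (r (t + T) - g (x t, u t)) + E2 t)).
Proof.
move=> g_diff traj nonsing t t0 dr.
have dx := has_time_derivative_is_derive _ _ _ t0 (state_equation traj (ltW t0)).
have du := has_time_derivative_is_derive _ _ _ t0
  (controller_equation traj (ltW t0) dr).
have dg := is_derive_partials _ _ _ _ _ _ (g_diff (x t, u t)) dx du.
have drT := is_derive_shift _ _ _ _ (derivableP dr).
have := is_deriveB drT dg.
rewrite -/(dg_dx g (x t) (u t)) -/(dg_du g (x t) (u t)).
rewrite mulmxKV ?nonsing ?ltW // (predictor_equation traj (ltW t0)).
set A := _ *m _; set D := 'D_1 r _; set a := _ *: _.
have -> // : D - (A + (a + D - A + E2 t)) = - (a + E2 t).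
rewrite [_ - A + _]addrAC [A + _]addrC subrK.
by rewrite [a + D + _]addrAC opprD addrCA subrr addr0.
Qed.

(** Half of [eps] pays for replacing the limsup by an eventual bound on [E2], the other half for the
    decaying initial term. *)
Lemma near_prediction_error_le {R : realType} {n m : nat} {T alpha : R}
    {f : 'rV[R]_n * 'rV[R]_m -> 'rV[R]_n} {h : 'rV[R]_n -> 'rV[R]_m}
    {g : 'rV[R]_n * 'rV[R]_m -> 'rV[R]_m} {r E2 : R -> 'rV[R]_m}
    {x0 : 'rV[R]_n} {x : R -> 'rV[R]_n} {u y yhat : R -> 'rV[R]_m}
    (eta2 eps : R) :
  0 < T -> 0 < alpha -> (forall p, differentiable g p) ->
  {within `[0, +oo[, continuous r} -> piecewise_differentiable r ->
  closed_loop_trajectory T alpha f h g r E2 x0 x u y yhat ->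
  nonsingular_trajectory g x u -> 0 < eps ->
  (limsup_enorm E2 <= eta2%:E)%E ->
  \forall t \near +oo, enorm (r (t + T) - yhat (t + T)) <= eta2 / alpha + eps.
Proof.
move=> T_gt0 alpha_gt0 g_diff r_cont [S Sfin dS] traj nonsing eps0 E2eta.
pose err t := r (t + T) - g (x t, u t).
(* Strictly above [eta2], and such that c / alpha = eta2 / alpha + eps / 2. *)
pose c := eta2 + eps * alpha / 2.
have eta2_ge0 : 0 <= eta2.
  by rewrite -lee_fin; apply: le_trans E2eta; exact: limsup_enorm_ge0.
have c_ge0 : 0 <= c by rewrite addr_ge0 // ?mulr_ge0 ?invr_ge0 ?ltW.
have [M [_ E2c]] : \forall t \near +oo, enorm (E2 t) <= c.
  apply: near_limsup_enorm_lt; apply: le_lt_trans E2eta _.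
  by rewrite lte_fin ltrDl !mulr_gt0 // invr_gt0.
(* The maximum with 1 keeps [a] positive, so that every later time has two-sided derivatives. *)
pose a := Num.max M 1.
have a_gt0 : 0 < a by rewrite lt_max ltr01 orbT.
pose K := enorm (err a).
have K_ge0 : 0 <= K by exact: enorm_ge0.
near=> t.
(* This delay makes alpha (t - a) eps / 2 >= K; since exp(s) >= 1 + s, the term K exp(- alpha (t -
   a)) then falls below eps / 2. *)
have at' : a + 2 * K / (eps * alpha) <= t.
  by near: t; exact: nbhs_pinfty_ge (num_real _).
have ea0 : 0 < eps * alpha by rewrite mulr_gt0.
have le_at : a <= t.
  by apply: le_trans at'; rewrite lerDl !mulr_ge0 ?invr_ge0 ?(ltW ea0).
have t0 : 0 < t := lt_le_trans a_gt0 le_at.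
rewrite (predictor_equation traj (ltW t0)) -/(err t).
(* The error at time b involves r at b + T, so its exceptional times are the break points in
   [0, t + T] moved back by [T]. *)
have /finite_seqP[s sE] := Sfin (t + T).
have := @enorm_linear_ode_le R m err E2 [seq b - T | b <- s] alpha c a t
  alpha_gt0 c_ge0 le_at.
move=> /(_ _ _ _)/le_trans; apply.
- by move=> b /andP[ab _]; apply: (continuous_prediction_error T_gt0 g_diff
    r_cont traj); exact: lt_le_trans ab.
- move=> b /andP[ab bt] bs; have b0 := lt_trans a_gt0 ab.
  apply: (is_derive_prediction_error g_diff traj nonsing) => //.
  apply: dS; first exact: addr_gt0.
  move=> Sb; have bTs : [set` s] (b + T).
    rewrite -sE; split=> //=.
    by rewrite in_itv/= lerD2r (ltW bt) addr_ge0 ?(ltW b0) ?(ltW T_gt0).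
  move/negP: bs; apply.
  by apply/mapP; exists (b + T) => //; rewrite addrK.
- move=> b /andP[ab _]; apply: E2c; apply: le_lt_trans ab.
  by rewrite le_max lexx.
have -> : c / alpha = eta2 / alpha + eps / 2.
  by rewrite /c; field; rewrite gt_eqF.
rewrite -addrA lerD2l expRN -/K.
have q : 1 + alpha * (t - a) <= expR (alpha * (t - a)) by exact: expR_ge1Dx.
suff : (expR (alpha * (t - a)))^-1 * K <= eps / 2 by lra.
rewrite mulrC ler_pdivrMr ?expR_gt0 //.
have : 2 * K <= (t - a) * (eps * alpha) by rewrite -ler_pdivrMr // lerBrDl.
nra.
Unshelve. all: by end_near. Qed.

Theorem corollary3p5 (R : realType) (n m : nat) (T alpha : R)
    (f : 'rV[R]_n * 'rV[R]_m -> 'rV[R]_n) (h : 'rV[R]_n -> 'rV[R]_m)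
    (g : 'rV[R]_n * 'rV[R]_m -> 'rV[R]_m) (r E2 : R -> 'rV[R]_m)
    (x0 : 'rV[R]_n) (x : R -> 'rV[R]_n) (u y yhat : R -> 'rV[R]_m)
    (eta1 eta2 : \bar R)
    (T_gt0 : 0 < T) (alpha_gt1 : 1 < alpha)
    (f_C1 : continuously_differentiable f) (f_growth : linear_growth f)
    (h_C1 : continuously_differentiable h)
    (g_C1 : continuously_differentiable g)
    (r_cont : {within `[0, +oo[, continuous r})
    (r_pdiff : piecewise_differentiable r)
    (traj : closed_loop_trajectory T alpha f h g r E2 x0 x u y yhat)
    (nonsing : nonsingular_trajectory g x u)
    (eta1E : eta1 = limsup_enorm (fun t => yhat (t + T) - y (t + T)))
    (eta2E : eta2 = limsup_enorm E2) :
  (limsup_enorm (fun t => r t - y t)%R <= eta1 + eta2 * (alpha^-1)%:E)%E.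
Proof.
have alpha_gt0 : 0 < alpha := lt_trans ltr01 alpha_gt1.
have eta1_ge0 : (0 <= eta1)%E by rewrite eta1E limsup_enorm_ge0.
have eta2_ge0 : (0 <= eta2)%E by rewrite eta2E limsup_enorm_ge0.
(* If [eta1] or [eta2] is infinite the bound is [+oo]: both being nonnegative, no indeterminate sum
   can occur. *)
case: eta2 eta2_ge0 eta2E => [e2| |] // _ eta2E; last first.
  rewrite gt0_mulye ?lte_fin ?invr_gt0 // addey ?leey //.
  by rewrite gt_eqF // (lt_le_trans _ eta1_ge0).
case: eta1 eta1_ge0 eta1E => [e1| |] // _ eta1E; last first.
  by rewrite -EFinM addye // leey.
rewrite -EFinM -EFinD; apply/lee_addgt0Pr => eps eps0; rewrite -EFinD.
apply: limsup_enorm_le.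
have eps20 : 0 < eps / 2 by rewrite divr_gt0.
have track := near_prediction_error_le e2 (eps / 2) T_gt0 alpha_gt0 g_C1.1 r_cont
  r_pdiff traj nonsing eps20.
have pred : \forall t \near +oo,
    enorm (yhat (t + T) - y (t + T)) <= e1 + eps / 2.
  by apply: near_limsup_enorm_lt; rewrite -eta1E lte_fin ltrDl.
(* Tracking error = prediction error + predictor mismatch at the common time t + T, each allotted
   eps / 2. *)
have shifted : \forall t \near +oo,
    enorm (r (t + T) - y (t + T)) <= e1 + e2 / alpha + eps.
  near=> t; have -> : r (t + T) - y (t + T) =
    (r (t + T) - yhat (t + T)) + (yhat (t + T) - y (t + T)).
    by rewrite addrA subrK.
  apply: le_trans (enormD _ _) _.
  have : enorm (r (t + T) - yhat (t + T)) <= e2 / alpha + eps / 2.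
    by near: t; apply: track; rewrite -eta2E.
  have : enorm (yhat (t + T) - y (t + T)) <= e1 + eps / 2 by near: t.
  lra.
(* Moving the threshold from [M] to [M + T] undoes the lookahead shift. *)
have [M [_ shiftedM]] := shifted; exists (M + T); split; first exact: num_real.
by move=> t; rewrite -ltrBrDr => /shiftedM; rewrite subrK.
Unshelve. all: by end_near. Qed.
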